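(* Let $\varphi\colon\mathbb{R}\to[0,+\infty]$ be a lower semicontinuous convex function such that $\operatorname{dom}(\varphi)=\,]0,+\infty[$ or $\operatorname{dom}(\varphi)=[0,+\infty[$, and $\varphi(1)=0$. Let $\epsilon\in\,]0,+\infty[$ and let $\alpha=\iota_{\mathbb{B}^\varphi_\epsilon}$ be the indicator function of $$\mathbb{B}^\varphi_\epsilon=\{q\in\mathcal{M}_1\mid D_\varphi(q,p)\le\epsilon\}.$$ Then the problem of finding $$\overline{\theta}\in\operatorname*{arg\,min}_{\theta\in\mathbb{R}^n}\ \sup_{q\in\mathcal{M}_1}\Big(\sum_{i=1}^N q_i\,\ell(\theta,z_i)-\alpha(q)\Big)$$ is equivalent to (i.e. has the same set of solutions $\overline{\theta}$ as) finding $$\overline{\theta}\in\operatorname*{arg\,min}_{\theta\in\mathbb{R}^n}\ \min_{(\lambda,\mu)\in\mathbb{R}^2}\ g(\theta,\lambda,\mu),$$ where $g$ is the proper, lower semicontinuous, convex function given, for every $\theta\in\mathbb{R}^n$ and $(\lambda,\mu)\in\mathbb{R}^2$, by $$g(\theta,\lambda,\mu)=\begin{cases}\displaystyle\lambda\epsilon+\mu+\sum_{i=1}^N p_i\,\lambda\,\varphi^*\Big(\frac{\ell(\theta,z_i)-\mu}{\lambda}\Big)&\text{if }\lambda\in[0,+\infty[,\\ +\infty&\text{otherwise,}\end{cases}$$ with the convention $0\,\varphi^*\big(\tfrac{\cdot}{0}\big)=\iota_{]-\infty,0]}$.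
   Context: Setting. $\Omega=\{\omega_1,\dots,\omega_N\}$ is a finite set of cardinality $N\ge 1$ with a probability distribution $p=(p_i)_{1\le i\le N}$ charging all points ($p_i>0$ for every $i$). $\mathcal{M}_1$ is the set of probability distributions on $\Omega$, identified with $\{q\in\mathbb{R}^N\mid q_i\ge 0\text{ for all }i,\ \sum_{i=1}^N q_i=1\}$. Let $d,n\ge 1$ be integers and let $z_1,\dots,z_N\in\mathbb{R}^d$ be the values of a random variable $\mathbf{z}\colon\Omega\to\mathbb{R}^d$. For every $i\in\{1,\dots,N\}$, $\ell(\cdot,z_i)\colon\mathbb{R}^n\to\mathbb{R}\cup\{+\infty\}$ is a lower semicontinuous convex function, and $\bigcap_{i=1}^N\operatorname{dom}\ell(\cdot,z_i)\ne\varnothing$. The domain of a function is the set of points at which it is finite. The indicator function $\iota_C$ of a set $C$ equals $0$ on $C$ and $+\infty$ elsewhere. The conjugate of $\varphi$ is $\varphi^*(s)=\sup_{t\in\mathbb{R}}(st-\varphi(t))$ for $s\in\mathbb{R}$. The $\varphi$-divergence $D_\varphi\colon\mathbb{R}^N\times\mathbb{R}^N\to[0,+\infty]$ is $D_\varphi(a,b)=\sum_{i=1}^N\underline{f_\varphi}(a_i,b_i)$, where $$\underline{f_\varphi}(x,\xi)=\begin{cases}\xi\,\varphi(x/\xi)&\text{if }\xi>0\text{ and }x\ge 0,\\ x\lim_{t\to+\infty}\varphi(t)/t&\text{if }\xi=0\text{ and }x>0,\\ 0&\text{if }\xi=0\text{ and }x=0,\\ +\infty&\text{otherwise.}\end{cases}$$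 In particular, since $p_i>0$ for all $i$, $D_\varphi(q,p)=\sum_{i=1}^N p_i\varphi(q_i/p_i)$ for $q\in\mathcal{M}_1$. Conventions for infinite losses: $0\cdot(+\infty)=0$ in the terms $q_i\,\ell(\theta,z_i)$; the supremum over $q$ is effectively over $q\in\operatorname{dom}\alpha=\mathbb{B}^\varphi_\epsilon$ (other terms count as $-\infty$); $\varphi^*(+\infty)=+\infty$ and $\iota_{]-\infty,0]}(+\infty)=+\infty$. These play no role if all losses are finite-valued. *)

(* Defs.v *)
(* MathComp / MathComp-Analysis; R is an arbitrary realType. *)
From HB Require Import structures.
From mathcomp Require Import all_boot all_order all_algebra.
From mathcomp Require Import all_classical all_reals all_analysis.
Set Implicit Arguments.
Unset Strict Implicit.
Unset Printing Implicit Defensive.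
Import Order.TTheory GRing.Theory Num.Theory.
Import numFieldNormedType.Exports.
Local Open Scope classical_set_scope.
Local Open Scope ring_scope.
Local Open Scope ereal_scope.

Section extended_functions.
Context {R : realType}.

Definition edom (T : Type) (f : T -> \bar R) : set T :=
  [set x | f x \is a fin_num].

Definition proper_efun (T : Type) (f : T -> \bar R) : Prop :=
  (forall x, -oo < f x) /\ edom f !=set0.

(* Meant for functions with values in ]-oo, +oo], for which the right-hand
   side never involves -oo + +oo. *)
Definition convex_efun (E : lmodType R) (f : E -> \bar R) : Prop :=
  forall (x y : E) (t : R), (0 < t < 1)%R ->
    f (t *: x + (1 - t) *: y)%R <= t%:E * f x + (1 - t)%:E * f y.

Definition indicator (T : Type) (C : set T) (x : T) : \bar R :=
  if x \in C then 0 else +oo.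

Definition argmin (T : Type) (f : T -> \bar R) : set T :=
  [set x | forall y, f x <= f y].

Definition conjugate (phi : R -> \bar R) (s : R) : \bar R :=
  ereal_sup (range (fun t : R => (s * t)%:E - phi t)).

(* phi^*(+oo) = +oo. The value at -oo is irrelevant: it is only needed for
   losses equal to -oo. *)
Definition conjugate_ext (phi : R -> \bar R) (s : \bar R) : \bar R :=
  match s with
  | r%:E => conjugate phi r
  | +oo => +oo
  | -oo => -oo
  end.

(* lambda phi^*(s / lambda) for lambda >= 0, where 0 phi^*(./0) is the indicator
   of ]-oo, 0] (equal to +oo at s = +oo). *)
Definition conjugate_persp (phi : R -> \bar R) (lambda : R) (s : \bar R) :
    \bar R :=
  if lambda == 0%R then indicator [set s' : \bar R | s' <= 0] s
  else lambda%:E * conjugate_ext phi (s * (lambda^-1)%:E).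

End extended_functions.

Section divergence.
Context {R : realType}.

Definition prob_simplex (N : nat) : set 'rV[R]_N :=
  [set q | (forall i, (0 <= q 0 i)%R) /\ (\sum_i q 0 i = 1)%R].

Definition divergence_term (phi : R -> \bar R) (x xi : R) : \bar R :=
  if (0 < xi)%R && (0 <= x)%R then xi%:E * phi (x / xi)%R
  else if (xi == 0%R) && (0 < x)%R then
    x%:E * lim ((fun t : R => phi t * (t^-1)%:E) @ +oo%R)
  else if (xi == 0%R) && (x == 0%R) then 0
  else +oo.

Definition phi_divergence (phi : R -> \bar R) (N : nat) (a b : 'rV[R]_N) :
    \bar R :=
  \sum_i divergence_term phi (a 0%R i) (b 0%R i).

Definition divergence_ball (phi : R -> \bar R) (N : nat) (p : 'rV[R]_N)
    (eps : R) : set 'rV[R]_N :=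
  [set q | prob_simplex q /\ phi_divergence phi q p <= eps%:E].

End divergence.

Section objectives.
Context {R : realType} {N d n : nat}.
Variables (ell : 'rV[R]_n -> 'rV[R]_d -> \bar R) (z : 'I_N -> 'rV[R]_d).

(* In \bar R one has 0 * +oo = 0 and +oo - +oo = -oo, so that every q with
   alpha q = +oo contributes -oo to the supremum, even if the loss is +oo. *)
Definition robust_loss (alpha : 'rV[R]_N -> \bar R) (theta : 'rV[R]_n) :
    \bar R :=
  ereal_sup [set (\sum_i (q 0%R i)%:E * ell theta (z i)) - alpha q
            | q in @prob_simplex R N].

Definition dual_objective (phi : R -> \bar R) (p : 'rV[R]_N) (eps : R)
    (theta : 'rV[R]_n) (lambda mu : R) : \bar R :=
  if (0 <= lambda)%R then
    (lambda * eps + mu)%:E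
    + \sum_i (p 0%R i)%:E *
        conjugate_persp phi lambda (ell theta (z i) - mu%:E)
  else +oo.

End objectives.

(* Main.v *)
Require Import Defs.
From HB Require Import structures.
From mathcomp Require Import all_boot all_order all_algebra.
From mathcomp Require Import all_classical all_reals all_analysis.
From mathcomp Require Import ring lra.
Import Order.TTheory GRing.Theory Num.Theory.
Import numFieldNormedType.Exports.
Local Open Scope classical_set_scope.
Local Open Scope ring_scope.

(** For a fixed decision theta, the inner supremum is a finite-dimensional
    concave maximization over the ball around p, and g theta lambda mu is its
    Lagrangian dual function, lambda being the multiplier of the constraint
    D_phi(q, p) <= eps and mu that of sum q = 1. It therefore suffices to
    prove, for every theta, that the supremum equals the minimum of g theta
    over (lambda, mu), the minimum being attained: the two functions of theta
    are then the same, and so are their minimizers.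

    Everything is written in terms of the density t_i = q_i / p_i. The key
    formula is [conjugate_persp_sup]: for lambda >= 0, the perspective
    lambda phi^*(s / lambda) is the supremum of t s - lambda phi(t) over the
    t > 0, and the convention at lambda = 0 is what makes the formula hold
    there too. Restricting to t > 0 matters: phi is finite there whichever
    form its domain has, and by convexity the point 0 contributes no more than
    the limit of what the points near 0 contribute.

    The formula exhibits g as a sum of suprema of functions of
    (theta, lambda, mu) which are lower semicontinuous and convex, each being
    a positive multiple of a loss plus a function that is affine in
    (lambda, mu); this gives the regularity of g. The inequality
    [fenchel_young], summed over i, gives weak duality: the supremum is at
    most g.

    Strong duality uses Slater's condition: q = p satisfies the divergence
    constraint strictly and has positive entries. Rather than separating
    convex sets in the space of both constraints, the two multipliers are
    produced one after the other, by two applications of an elementary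
    separation lemma for convex sets of the plane ([planar_separation]). That
    lemma needs points of the set on both sides of the axis: for lambda they
    come from D(p, p) = 0 < eps, and for mu from the constant densities 1/2
    and 2. The outcome is a bound on a sum of terms in which each t_i > 0 is
    free, hence on the sum of their suprema ([sum_sup_le]), which is g.

    If some loss is +oo at theta, both sides are +oo, since p charges all
    points. *)

(** * Separation in the plane *)

(** The chord from a point of C with g < 0 to a point of C with g > 0 crosses
    the axis g = 0 at or below V. Hence the slopes from (0, V) to the points on
    the right are at most the slopes to the points on the left, and the
    supremum of the former is the slope of a line above C. *)
Lemma planar_separation (R : realType) (C : R -> R -> Prop)
    (V gm fm gp fp : R) :
  (forall a g f g' f', 0 < a < 1 -> C g f -> C g' f' ->
    C (a * g + (1 - a) * g') (a * f + (1 - a) * f')) ->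
  (forall f, C 0 f -> f <= V) ->
  C gm fm -> gm < 0 -> C gp fp -> 0 < gp ->
  exists mu, forall g f, C g f -> f - mu * g <= V.
Proof.
move=> Cconv CV Cm gm0 Cp gp0.
have slopes g f g' f' : C g f -> g < 0 -> C g' f' -> 0 < g' ->
    (f' - V) / g' <= (f - V) / g.
  move=> Cg g0 Cg' g'0.
  have d0 : 0 < g' - g by lra.
  have a01 : 0 < g' / (g' - g) < 1.
    by rewrite divr_gt0//= ltr_pdivrMr//; lra.
  have := Cconv _ _ _ _ _ a01 Cg Cg'.
  (* This weight makes the combined first coordinate vanish. *)
  have -> : g' / (g' - g) * g + (1 - g' / (g' - g)) * g' = 0.
    by field; lra.
  have -> : g' / (g' - g) * f + (1 - g' / (g' - g)) * f' =
            (g' * f - g * f') / (g' - g) by field; lra.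
  move/CV; rewrite ler_pdivrMr// => le.
  rewrite ler_pdivrMr// -mulrAC ler_ndivlMr//.
  by nra.
set S := [set s | exists g f, [/\ C g f, 0 < g & s = (f - V) / g]].
have S0 : S !=set0 by exists ((fp - V) / gp), gp, fp.
have Sub : ubound S ((fm - V) / gm).
  by move=> _ [g [f [Cg g0 ->]]]; exact: slopes.
exists (sup S) => g f Cg; have [g0|g0|g0] := ltgtP g 0.
- suff : sup S <= (f - V) / g by rewrite ler_ndivlMr//; lra.
  by apply: ge_sup => // _ [g' [f' [Cg' g'0 ->]]]; exact: slopes.
- suff : (f - V) / g <= sup S by rewrite ler_pdivrMr//; lra.
  apply: ub_le_sup; first by exists ((fm - V) / gm).
  by exists g, f.
- by rewrite g0 mulr0 subr0; apply: CV; rewrite -g0.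
Qed.

(** * Multipliers for the divergence and mass constraints *)

Section lagrange.
Context {R : realType} {I : finType} (p l : I -> R) (f : R -> R).
Hypothesis p_gt0 : forall i, 0 < p i.
Hypothesis sum_p : \sum_i p i = 1.
Hypothesis f1 : f 1 = 0.
Hypothesis f_convex : forall x y a, 0 < x -> 0 < y -> 0 < a < 1 ->
  f (a * x + (1 - a) * y) <= a * f x + (1 - a) * f y.

Let sum_cvx (F G : I -> R) a :
  \sum_i p i * (a * F i + (1 - a) * G i) =
  a * (\sum_i p i * F i) + (1 - a) * (\sum_i p i * G i).
Proof. by rewrite !mulr_sumr -big_split/=; apply: eq_bigr => i _; ring. Qed.

Let sum_f_cvx (s t : I -> R) a : (forall i, 0 < s i) -> (forall i, 0 < t i) ->
  0 < a < 1 ->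
  \sum_i p i * f (a * s i + (1 - a) * t i) <=
  a * (\sum_i p i * f (s i)) + (1 - a) * (\sum_i p i * f (t i)).
Proof.
move=> s0 t0 a01; rewrite -sum_cvx ler_sum// => i _.
by apply: ler_wpM2l; [exact: ltW|exact: f_convex].
Qed.

Let sum_l_cvx (s t : I -> R) a :
  \sum_i p i * ((a * s i + (1 - a) * t i) * l i) =
  a * (\sum_i p i * (s i * l i)) + (1 - a) * (\sum_i p i * (t i * l i)).
Proof. by rewrite -sum_cvx; apply: eq_bigr => i _; ring. Qed.

Let cvx_gt0 (s t : I -> R) a : (forall i, 0 < s i) -> (forall i, 0 < t i) ->
  0 < a < 1 -> forall i, 0 < a * s i + (1 - a) * t i.
Proof.
move=> s0 t0 /andP[a0 a1] i.
by rewrite addr_gt0// mulr_gt0// subr_gt0.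
Qed.

Let sum_cst c : \sum_i p i * c = c.
Proof. by rewrite -mulr_suml sum_p mul1r. Qed.

(** The plane set collects the pairs (slack, value) of probability densities
    t; raising the slack keeps a pair in the set, which is why the multiplier
    is nonnegative. The constant density 1, which has divergence 0, provides
    the points of slack eps and - eps. *)
Lemma divergence_lagrange (eps V : R) : 0 < eps ->
  (forall t, (forall i, 0 < t i) -> \sum_i p i * t i = 1 ->
    \sum_i p i * f (t i) <= eps -> \sum_i p i * (t i * l i) <= V) ->
  exists2 lambda, 0 <= lambda &
    forall t, (forall i, 0 < t i) -> \sum_i p i * t i = 1 ->
    \sum_i p i * (t i * l i) - lambda * (\sum_i p i * f (t i) - eps) <= V.
Proof.
move=> eps0 primal.
pose C g v := exists t, [/\ forall i, 0 < t i, \sum_i p i * t i = 1,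
  \sum_i p i * f (t i) <= g + eps & v = \sum_i p i * (t i * l i)].
have C1 g : - eps <= g -> C g (\sum_i p i * (1 * l i)).
  move=> eg; exists (fun=> 1); split => //; rewrite sum_cst ?f1//; lra.
have CV v : C 0 v -> v <= V.
  by case=> t [t0 t1 tD ->]; apply: primal => //; rewrite add0r in tD.
have Cconv a g v g' v' : 0 < a < 1 -> C g v -> C g' v' ->
    C (a * g + (1 - a) * g') (a * v + (1 - a) * v').
  move=> a01 [s [s0 s1 sD ->]] [t [t0 t1 tD ->]].
  exists (fun i => a * s i + (1 - a) * t i); split.
  - exact: cvx_gt0.
  - by rewrite sum_cvx s1 t1; ring.
  - by apply: le_trans (sum_f_cvx s t a _ _ _) _ => //; nra.
  - by rewrite sum_l_cvx.
have [lambda lamP] := planar_separation _ C V _ _ _ _ Cconv CV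
  (C1 (- eps) (lexx _)) (ltac:(lra)) (C1 eps (ltac:(lra))) eps0.
exists lambda.
  rewrite leNgt; apply/negP => lam0.
  (* A slack this large would push the point of density 1 above the line. *)
  set E := \sum_i p i * (1 * l i) in C1.
  have EV : E <= V by apply: CV; apply: C1; lra.
  have k0 : 0 <= (V - E + 1) / - lambda by rewrite divr_ge0; lra.
  have := lamP _ _ (C1 ((V - E + 1) / - lambda) (ltac:(lra))).
  have -> : lambda * ((V - E + 1) / - lambda) = - (V - E + 1) by field; lra.
  lra.
move=> t t0 t1; apply: lamP; exists t; split => //; lra.
Qed.

(** The penalized objective is now maximized over densities of arbitrary mass
    1 + g; the hypograph is taken, since the objective is concave and not
    affine in t. *)
Lemma mass_lagrange (lambda eps V : R) : 0 <= lambda ->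
  (forall t, (forall i, 0 < t i) -> \sum_i p i * t i = 1 ->
    \sum_i p i * (t i * l i) - lambda * (\sum_i p i * f (t i) - eps) <= V) ->
  exists mu, forall t, (forall i, 0 < t i) ->
    lambda * eps + mu + \sum_i p i * (t i * (l i - mu) - lambda * f (t i)) <= V.
Proof.
move=> lam0 primal.
pose C g v := exists t, [/\ forall i, 0 < t i, \sum_i p i * t i = 1 + g &
  v <= \sum_i p i * (t i * l i) - lambda * (\sum_i p i * f (t i) - eps)].
have CV v : C 0 v -> v <= V.
  case=> t [t0 t1 vt]; apply: le_trans vt _; apply: primal => //.
  by rewrite t1 addr0.
have Ccst c : 0 < c -> C (c - 1)
    (\sum_i p i * (c * l i) - lambda * (\sum_i p i * f c - eps)).
  by move=> c0; exists (fun=> c); split => //; rewrite sum_cst; ring.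
have Cconv a g v g' v' : 0 < a < 1 -> C g v -> C g' v' ->
    C (a * g + (1 - a) * g') (a * v + (1 - a) * v').
  move=> a01 [s [s0 s1 vs]] [t [t0 t1 vt]].
  exists (fun i => a * s i + (1 - a) * t i); split.
  - exact: cvx_gt0.
  - by rewrite sum_cvx s1 t1; ring.
  - have := ler_wpM2l lam0 (sum_f_cvx s t a s0 t0 a01).
    rewrite sum_l_cvx; move/andP: a01 => [a0 a1].
    have := ler_wpM2l (ltW a0) vs.
    have a1' : 0 <= 1 - a by lra.
    have := ler_wpM2l a1' vt.
    lra.
have [mu muP] := planar_separation _ C V _ _ _ _ Cconv CV
  (Ccst (1/2) (ltac:(lra))) (ltac:(lra)) (Ccst 2 (ltac:(lra))) (ltac:(lra)).
exists mu => t t0.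
have /muP : C (\sum_i p i * t i - 1)
    (\sum_i p i * (t i * l i) - lambda * (\sum_i p i * f (t i) - eps)).
  by exists t; split => //; ring.
apply: le_trans; rewrite le_eqVlt; apply/orP; left; apply/eqP.
rewrite (eq_bigr (fun i => p i * (t i * l i) - mu * (p i * t i)
  - lambda * (p i * f (t i)))); last by move=> i _; ring.
by rewrite !sumrB -!mulr_sumr; ring.
Qed.

End lagrange.

Local Open Scope ereal_scope.

(** * Sums of extended reals *)

Lemma mule_gtNy {R : realType} (c : R) (u : \bar R) : (0 < c)%R ->
  -oo < u -> -oo < c%:E * u.
Proof.
move=> c0; case: u => [u _| _|//]; first by rewrite -EFinM ltNyr.
by rewrite gt0_muley// lte_fin.
Qed.

Lemma adde_gtNy {R : realType} (u v : \bar R) :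
  -oo < u -> -oo < v -> -oo < u + v.
Proof. by move=> u0 v0; rewrite -[-oo]/(-oo + -oo) lteD. Qed.

Lemma sume_gtNy {R : realType} (I : Type) (s : seq I) (P : pred I)
  (F : I -> \bar R) : (forall i, -oo < F i) -> -oo < \sum_(i <- s | P i) F i.
Proof. by move=> F0; elim/big_ind: _ => //; exact: adde_gtNy. Qed.

(** The terms are chosen independently, so each supremum is finite (freeze the
    other terms at a0) and can be approached within e simultaneously; as the
    weights add up to 1, the total error is e. *)
Lemma sum_sup_le {R : realType} (I : finType) (T : Type) (A : set T) (a0 : T)
    (p : I -> R) (F : I -> T -> R) (c V : R) :
  A a0 -> (forall i, 0 < p i)%R -> (\sum_i p i = 1)%R ->
  (forall t, (forall i, A (t i)) -> (c + \sum_i p i * F i (t i) <= V)%R) ->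
  c%:E + \sum_i (p i)%:E * ereal_sup [set (F i t)%:E | t in A] <= V%:E.
Proof.
move=> Aa0 p0 p1 le; pose h i := ereal_sup [set (F i t)%:E | t in A].
have hfin i : h i \is a fin_num.
  rewrite fin_numElt; apply/andP; split.
    apply: (lt_le_trans (ltNyr (F i a0))).
    by apply: ereal_sup_ubound; exists a0.
  apply: (@le_lt_trans _ _
    ((V - c - \sum_(j | j != i) p j * F j a0) / p i)%R%:E); last exact: ltry.
  apply: ge_ereal_sup => _ [a Aa <-]; rewrite lee_fin ler_pdivlMr//.
  have := le (fun j => if j == i then a else a0).
  rewrite (bigD1 i)//= eqxx.
  rewrite (eq_bigr (fun j => p j * F j a0))%R; last first.
    by move=> j /negbTE ->.
  by move=> /(_ (fun j => _)) H; have := H (ltac:(by move=> j; case: eqP)); lra.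
rewrite (eq_bigr (fun i => (p i * fine (h i))%:E)); last first.
  by move=> i _; rewrite EFinM fineK.
rewrite sumEFin -EFinD lee_fin; apply/ler_addgt0Pr => e e0.
have /choice[t tP] : forall i, exists a, A a /\ (fine (h i) - e < F i a)%R.
  move=> i; have [_ [a Aa <-] ha] := ub_ereal_sup_adherent e0 (hfin i).
  by exists a; split => //; rewrite -lte_fin EFinB fineK.
have := le t (fun i => proj1 (tP i)).
have : (\sum_i p i * (fine (h i) - e) <= \sum_i p i * F i (t i))%R.
  by apply: ler_sum => i _; apply: ler_wpM2l; apply: ltW => //; case: (tP i).
under eq_bigr do rewrite mulrBr.
rewrite sumrB -mulr_suml p1; lra.
Qed.

(** * Lower semicontinuity *)

Section semicontinuity.
Context {R : realType} {X : topologicalType}.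
Implicit Types f g : X -> \bar R.

Lemma lower_semicontinuousD f g : (forall x, -oo < f x) ->
  (forall x, -oo < g x) ->
  lower_semicontinuous f -> lower_semicontinuous g ->
  lower_semicontinuous (fun x => f x + g x).
Proof.
move=> f_gt g_gt flsc glsc x a afg.
(* The gap between a and f x + g x is shared between f and g. *)
have [b [c [abc bf cg]]] : exists b c : R, [/\ (a <= b + c)%R,
    b%:E < f x & c%:E < g x].
  have := f_gt x; have := g_gt x; move: afg.
  case: (f x) => [u| |//]; case: (g x) => [v| |//] => afg _ _.
  - exists (u - (u + v - a) / 2)%R, (v - (u + v - a) / 2)%R.
    by move: afg; rewrite -EFinD !lte_fin => afg; split; lra.
  - exists (u - 1)%R, (a - u + 1)%R.
    by rewrite lte_fin ltry; split => //; lra.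
  - exists (a - v + 1)%R, (v - 1)%R.
    by rewrite lte_fin ltry; split => //; lra.
  - by exists a, 0%R; rewrite !ltry; split => //; lra.
have [U xU Uf] := flsc _ _ bf; have [W xW Wg] := glsc _ _ cg.
exists (U `&` W); first exact: filterI.
move=> y [/Uf bfy /Wg cgy]; apply: (@le_lt_trans _ _ (b%:E + c%:E)).
  by rewrite -EFinD lee_fin.
exact: lteD.
Qed.

Lemma lower_semicontinuousZl (c : R) f : (0 < c)%R ->
  lower_semicontinuous f -> lower_semicontinuous (fun x => c%:E * f x).
Proof.
move=> c0 flsc x a; rewrite -lte_pdivrMl// -EFinM => /flsc[U xU Uf].
by exists U => // y /Uf; rewrite EFinM lte_pdivrMl.
Qed.

Lemma lower_semicontinuous_continuous (h : X -> R) :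
  continuous h -> lower_semicontinuous (fun x => (h x)%:E).
Proof.
move=> hc; apply/lower_semicontinuousP => a.
exact: (open_comp (fun x _ => hc x) (open_gt (y := a))).
Qed.

Lemma lower_semicontinuous_sum (I : finType) (F : I -> X -> \bar R) :
  (forall i x, -oo < F i x) -> (forall i, lower_semicontinuous (F i)) ->
  lower_semicontinuous (fun x => \sum_i F i x).
Proof.
move=> F_gt Flsc; elim: (index_enum I) => [|i s IH].
  under [X in lower_semicontinuous X]eq_fun do rewrite big_nil.
  by apply: lower_semicontinuous_continuous => x; exact: cvg_cst.
under [X in lower_semicontinuous X]eq_fun do rewrite big_cons.
apply: lower_semicontinuousD => // x.
exact: sume_gtNy.
Qed.

Lemma lower_semicontinuous_sup (T : Type) (A : set T) (F : T -> X -> \bar R) :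
  (forall t, A t -> lower_semicontinuous (F t)) ->
  lower_semicontinuous (fun x => ereal_sup [set F t x | t in A]).
Proof.
move=> Flsc x a /ereal_sup_gt[_ [t At <-]] /(Flsc t At)[U xU UF].
exists U => // y /UF/lt_le_trans; apply.
by apply: ereal_sup_ubound; exists t.
Qed.

Lemma lower_semicontinuous_extend (D : {pred X}) f : closed [set` D] ->
  lower_semicontinuous f ->
  lower_semicontinuous (fun x => if x \in D then f x else +oo).
Proof.
move=> Dc flsc x a; case: ifPn => [xD /flsc[U xU Uf]|xD _].
  by exists U => // y /Uf; case: ifP => //; rewrite ltry.
exists (~` [set` D]).
  by apply: open_nbhs_nbhs; split; [exact: closed_openC|exact/negP].
by move=> y /negP/negbTE ->; rewrite ltry.
Qed.

End semicontinuity.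

Lemma lower_semicontinuous_comp (R : realType) (X Y : topologicalType)
    (h : X -> Y) (f : Y -> \bar R) : continuous h ->
  lower_semicontinuous f -> lower_semicontinuous (fun x => f (h x)).
Proof.
move=> hc /lower_semicontinuousP flsc; apply/lower_semicontinuousP => a.
exact: (open_comp (fun x _ => hc x) (flsc a)).
Qed.

(** * Convexity of extended-real functions *)

Section convexity.
Context {R : realType} {E : lmodType R}.
Implicit Types f g : E -> \bar R.

Lemma convex_efunD f g : (forall x, -oo < f x) -> (forall x, -oo < g x) ->
  convex_efun f -> convex_efun g -> convex_efun (fun x => f x + g x).
Proof.
move=> f_gt g_gt fc gc x y t t01.
apply: le_trans (leeD (fc x y t t01) (gc x y t t01)) _.
have defD (u : E) : f u +? g u by apply: ltninfty_adde_def; rewrite inE.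
by rewrite (muleDr _ (defD x))// (muleDr _ (defD y))// addeACA.
Qed.

Lemma convex_efunZl (c : R) f : (0 < c)%R -> (forall x, -oo < f x) ->
  convex_efun f -> convex_efun (fun x => c%:E * f x).
Proof.
move=> c0 f_gt fc x y t /[dup] t01 /andP[t0 t1].
rewrite !(muleCA _ c%:E) -muleDr//.
  by rewrite lee_pmul2l//; exact: fc.
by apply: ltninfty_adde_def; rewrite inE; apply: mule_gtNy;
  rewrite ?subr_gt0.
Qed.

Lemma convex_efun_sum (I : finType) (F : I -> E -> \bar R) :
  (forall i x, -oo < F i x) -> (forall i, convex_efun (F i)) ->
  convex_efun (fun x => \sum_i F i x).
Proof.
move=> F_gt Fc; elim: (index_enum I) => [|i s IH].
  by move=> x y t _; rewrite !big_nil !mule0 adde0.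
under [X in convex_efun X]eq_fun do rewrite big_cons.
apply: convex_efunD => // x.
exact: sume_gtNy.
Qed.

Lemma convex_efun_sup (T : Type) (A : set T) (F : T -> E -> \bar R) :
  (forall t, A t -> convex_efun (F t)) ->
  convex_efun (fun x => ereal_sup [set F t x | t in A]).
Proof.
move=> Fc x y a /[dup] a01 /andP[a0 a1].
apply: ge_ereal_sup => _ [t At <-]; apply: le_trans (Fc t At x y a a01) _.
by apply: leeD; rewrite lee_pmul2l ?lte_fin ?subr_gt0//;
  apply: ereal_sup_ubound; exists t.
Qed.

Lemma convex_efun_extend (D : {pred E}) f : (forall x, -oo < f x) ->
  (forall x y (t : R), (0 < t < 1)%R -> x \in D -> y \in D ->
    (t *: x + (1 - t) *: y)%R \in D) ->
  convex_efun f -> convex_efun (fun x => if x \in D then f x else +oo).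
Proof.
move=> f_gt Dc fc x y t /[dup] t01 /andP[t0 t1].
have t1' : (0 < 1 - t)%R by rewrite subr_gt0.
have [xD|_] := boolP (x \in D); last first.
  rewrite gt0_muley ?lte_fin// addye ?leey// gt_eqF//.
  by apply: mule_gtNy => //; case: ifP.
have [yD|_] := boolP (y \in D); last first.
  rewrite (gt0_muley (x := (1 - t)%:E)) ?lte_fin// addey ?leey// gt_eqF//.
  exact: mule_gtNy.
by rewrite Dc//; exact: fc.
Qed.

End convexity.

(** * The perspective of the conjugate *)

(** A bound on the points a r + c with a > 0 passes to the limit a = 0. This is
    how the value at t = 0 is controlled by those at t > 0. *)
Lemma affine_bound0 {R : realType} (r c B : R) :
  (forall a, 0 < a < 1 -> a * r + c <= B)%R -> (c <= B)%R.
Proof.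
move=> le; rewrite leNgt; apply/negP => Bc.
have n0 : (0 < `|r| + 1 + (c - B))%R by have := normr_ge0 r; lra.
pose a := ((c - B) / (`|r| + 1 + (c - B)))%R.
have a01 : (0 < a < 1)%R.
  rewrite divr_gt0//=; last lra.
  by rewrite ltr_pdivrMr//; have := normr_ge0 r; lra.
have := le a a01.
have ra : (a * (`|r| + 1 + (c - B)) = c - B)%R by rewrite divfK//; lra.
have : (- `|r| <= r)%R by rewrite lerNl -normrN ler_norm.
by move/andP : a01 => [a0 a1]; nra.
Qed.

Section perspective.
Context {R : realType} (phi : R -> \bar R).
Hypothesis phi_ge0 : forall t, 0 <= phi t.
Hypothesis phi_convex : convex_efun (phi : R^o -> \bar R).
Hypothesis phi_fin : forall t, (0 < t)%R -> phi t \is a fin_num.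
Hypothesis phi_neg : forall t, (t < 0)%R -> phi t = +oo.
Hypothesis phi1 : phi 1%R = 0.

Lemma fine_convex (x y a : R) : (0 < x -> 0 < y -> 0 < a < 1 ->
  fine (phi (a * x + (1 - a) * y)) <=
    a * fine (phi x) + (1 - a) * fine (phi y))%R.
Proof.
move=> x0 y0 /[dup] a01 /andP[a0 a1].
have /= := phi_convex x y a a01.
have c0 : (0 < a * x + (1 - a) * y)%R.
  by rewrite addr_gt0// mulr_gt0// subr_gt0.
rewrite -(fineK (phi_fin _ x0)) -(fineK (phi_fin _ y0)).
by rewrite -[X in X <= _](fineK (phi_fin _ c0)) -!EFinM -EFinD lee_fin.
Qed.

(** The chord over [0, 1], which lies above phi, decreases from phi(0) >= 0 to
    phi(1) = 0. *)
Lemma fine_phi_le0 (a : R) : (0 < a < 1)%R -> phi 0%R \is a fin_num ->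
  (fine (phi a) <= fine (phi 0))%R.
Proof.
move=> /[dup] a01 /andP[a0 a1] fin0.
have /= := phi_convex 1%R 0%R a a01.
rewrite phi1 mule0 add0e scaler0 addr0 (_ : (a *: (1 : R^o)) = a)%R; last first.
  by rewrite /GRing.scale/= mulr1.
rewrite -[X in X <= _](fineK (phi_fin _ a0)) -(fineK fin0) -EFinM lee_fin.
have := fine_ge0 (phi_ge0 0%R); nra.
Qed.

(** Unlike in [conjugate_persp_sup], t = 0 is allowed: an element of the ball
    may vanish at some points. *)
Lemma fenchel_young (lambda t : R) (s : \bar R) : (0 <= lambda)%R ->
  (0 <= t)%R -> phi t \is a fin_num -> -oo < s ->
  t%:E * s - (lambda * fine (phi t))%:E <= conjugate_persp phi lambda s.
Proof.
move=> lam0 t0 tfin; case: s => [r|_|//]; rewrite /conjugate_persp; last first.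
  case: eqP => [_|/eqP lamn0].
    rewrite /indicator ifF; first exact: leey.
    by apply/negbTE; rewrite notin_setE.
  have lamgt0 : (0 < lambda)%R by rewrite lt_neqAle eq_sym lamn0.
  rewrite gt0_mulye ?lte_fin ?invr_gt0//= (gt0_muley (x := lambda%:E))//.
  exact: leey.
move=> _; case: eqP => [->|/eqP lamn0].
  rewrite mul0r sube0 /indicator; case: ifPn; last by rewrite leey.
  by rewrite inE/= !lee_fin => r0; rewrite mulr_ge0_le0.
have lamgt0 : (0 < lambda)%R by rewrite lt_neqAle eq_sym lamn0.
rewrite -EFinM/=.
have -> : t%:E * r%:E - (lambda * fine (phi t))%:E =
    lambda%:E * ((r / lambda * t)%:E - phi t).
  rewrite -[in RHS](fineK tfin) -[RHS]EFinM -[LHS]EFinB.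
  by congr EFin; field; exact: lamn0.
rewrite lee_pmul2l//.
by apply: ereal_sup_ubound; exists t.
Qed.

(** At lambda = 0 the bounds on the t s for small and for large t give the two
    branches of the indicator of ]-oo, 0]; for lambda > 0 the conjugate is a
    supremum over all real t, where t < 0 contributes -oo and t = 0 at most
    a limit of contributions of t > 0. *)
Lemma conjugate_persp_le (lambda : R) (s B : \bar R) : (0 <= lambda)%R ->
  -oo < s ->
  (forall t, (0 < t)%R -> t%:E * s - (lambda * fine (phi t))%:E <= B) ->
  conjugate_persp phi lambda s <= B.
Proof.
move=> lam0 s_gt le.
case: s s_gt le => [r|_|//] => [_|] le; last first.
  by have := le 1%R ltr01; rewrite mul1e/= leye_eq => /eqP ->; rewrite leey.
case: B le => [b| |] le; last 2 first.
- by rewrite leey.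
- by have := le 1%R ltr01; rewrite mul1e -EFinB leeNy_eq.
have {}le t : (0 < t)%R -> (t * r - lambda * fine (phi t) <= b)%R.
  by move=> t0; rewrite -lee_fin EFinB EFinM; exact: le.
rewrite /conjugate_persp; case: eqP => [lam00|/eqP lamn0].
  rewrite /indicator; case: ifPn => [_|].
    rewrite lee_fin; apply: (affine_bound0 r) => a /andP[a0 a1].
    by have := le a a0; rewrite lam00 mul0r subr0 addr0.
  rewrite notin_setE/= lee_fin => /negP; rewrite -ltNge => r0.
  exfalso; have b1 := ler_norm b; have b2 := normr_ge0 b.
  have c0 : (0 < (`|b| + 1) / r)%R by apply: divr_gt0 => //; lra.
  have := le _ c0; rewrite lam00 mul0r subr0 divfK ?gt_eqF//; lra.
have lamgt0 : (0 < lambda)%R by rewrite lt_neqAle eq_sym lamn0.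
rewrite -EFinM/= -lee_pdivlMl// -EFinM; apply: ge_ereal_sup => _ [t _ <-].
have [t0|t0|->] := ltgtP t 0%R.
- by rewrite phi_neg// addeNy leNye.
- rewrite -(fineK (phi_fin _ t0)) -EFinB lee_fin.
  rewrite ler_pdivlMl// mulrBr.
  have -> : (lambda * (r / lambda * t) = t * r)%R by field.
  exact: le.
- rewrite mulr0 add0e.
  have [fin0|] := boolP (phi 0%R \is a fin_num); last first.
    rewrite fin_numE negb_and !negbK => /orP[|] /eqP phi0.
      by have := phi_ge0 0%R; rewrite phi0.
    by rewrite phi0 leNye.
  rewrite -(fineK fin0) -EFinN lee_fin ler_pdivlMl//.
  apply: (affine_bound0 r) => a a01.
  have /le : (0 < a)%R by case/andP: a01.
  have := ler_wpM2l lam0 (fine_phi_le0 _ a01 fin0); lra.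
Qed.

(** The representation from which the regularity of the dual objective and
    strong duality are both read off. *)
Lemma conjugate_persp_sup (lambda : R) (s : \bar R) : (0 <= lambda)%R ->
  -oo < s ->
  conjugate_persp phi lambda s =
  ereal_sup [set t%:E * s - (lambda * fine (phi t))%:E
            | t in [set t | (0 < t)%R]].
Proof.
move=> lam0 s_gt; apply/eqP; rewrite eq_le; apply/andP; split.
  apply: conjugate_persp_le => // t t0.
  by apply: ereal_sup_ubound; exists t.
apply: ge_ereal_sup => _ [t /= t0 <-].
by apply: fenchel_young => //; [exact: ltW|exact: phi_fin].
Qed.

Lemma conjugate_persp_gtNy (lambda : R) (s : \bar R) : (0 <= lambda)%R ->
  -oo < s -> -oo < conjugate_persp phi lambda s.
Proof.
move=> lam0 s_gt; have := fenchel_young _ _ _ lam0 ler01 (phi_fin _ ltr01) s_gt.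
rewrite phi1 mulr0 sube0 mul1e; exact: lt_le_trans.
Qed.

(** * Duality *)

Section objectives.
Variables (N d n : nat) (p : 'rV[R]_N) (eps : R).
Hypothesis p_simplex : prob_simplex p.
Hypothesis p_gt0 : forall i, (0 < p 0%R i)%R.
Hypothesis eps_gt0 : (0 < eps)%R.
Variables (ell : 'rV[R]_n -> 'rV[R]_d -> \bar R) (z : 'I_N -> 'rV[R]_d).
Hypothesis ell_gtNy : forall i theta, -oo < ell theta (z i).

Let ball := divergence_ball phi p eps.
Let robust := robust_loss ell z (indicator ball).
Let dual := dual_objective ell z phi p eps.

Let shift_gtNy i theta (mu : R) : -oo < ell theta (z i) - mu%:E.
Proof.
by have := ell_gtNy i theta; case: (ell theta (z i)) => // r _; exact: ltNyr.
Qed.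

Let term_gtNy i theta lambda mu : (0 <= lambda)%R ->
  -oo < (p 0%R i)%:E * conjugate_persp phi lambda (ell theta (z i) - mu%:E).
Proof. by move=> lam0; apply: mule_gtNy => //; exact: conjugate_persp_gtNy. Qed.

Lemma dual_objective_gtNy theta lambda mu : -oo < dual theta lambda mu.
Proof.
rewrite /dual /dual_objective; case: ifPn => // lam0.
by apply: adde_gtNy; [exact: ltNyr|apply: sume_gtNy => i; exact: term_gtNy].
Qed.

Lemma dual_objective_infinite theta lambda mu i : ell theta (z i) = +oo ->
  dual theta lambda mu = +oo.
Proof.
move=> ly; rewrite /dual /dual_objective; case: ifPn => // lam0.
rewrite (bigD1 i)//= ly.
have -> : conjugate_persp phi lambda (+oo - mu%:E) = +oo.
  have sy : -oo < +oo - mu%:E by [].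
  have := fenchel_young _ _ _ lam0 ler01 (phi_fin _ ltr01) sy.
  by rewrite phi1 mulr0 sube0 mul1e/= leye_eq => /eqP.
rewrite gt0_muley ?lte_fin// addye; first by rewrite addey.
by rewrite gt_eqF//; apply: sume_gtNy => j; exact: term_gtNy.
Qed.

Lemma divergence_simplex q : prob_simplex q ->
  phi_divergence phi q p = \sum_i (p 0%R i)%:E * phi (q 0%R i / p 0%R i)%R.
Proof.
move=> [q0 _]; apply: eq_bigr => i _.
by rewrite /divergence_term p_gt0 q0.
Qed.

Lemma reference_in_ball : ball p.
Proof.
split => //; rewrite divergence_simplex//.
rewrite big1 ?lee_fin ?ltW// => i _.
by rewrite divff ?gt_eqF// phi1 mule0.
Qed.

Lemma robust_loss_ge q theta : ball q ->
  \sum_i (q 0%R i)%:E * ell theta (z i) <= robust theta.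
Proof.
move=> qB; apply: ereal_sup_ubound; exists q; first by case: qB.
by rewrite /indicator mem_set// sube0.
Qed.

Lemma robust_loss_infinite theta i : ell theta (z i) = +oo ->
  robust theta = +oo.
Proof.
move=> ly; apply/eqP; rewrite -leye_eq.
apply: le_trans (robust_loss_ge _ theta reference_in_ball).
rewrite (bigD1 i)//= ly gt0_muley ?lte_fin// addye//.
by rewrite gt_eqF//; apply: sume_gtNy => j; exact: mule_gtNy.
Qed.

Lemma ball_divergence_le q : ball q ->
  (forall i, phi (q 0%R i / p 0%R i)%R \is a fin_num) /\
  (\sum_i p 0%R i * fine (phi (q 0%R i / p 0%R i)) <= eps)%R.
Proof.
move=> [qS]; rewrite divergence_simplex// => Deps.
have qfin i : phi (q 0%R i / p 0%R i)%R \is a fin_num.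
  rewrite ge0_fin_numE//; rewrite ltNge leye_eq; apply/negP => /eqP phiy.
  move: Deps; rewrite (bigD1 i)//= phiy gt0_muley ?lte_fin// addye ?leye_eq//.
  rewrite gt_eqF//; apply: (@lt_le_trans _ _ 0) => //.
  by apply: sume_ge0 => j _; rewrite mule_ge0// lee_fin ltW.
split => //; rewrite -lee_fin -sumEFin; apply: le_trans Deps.
by apply: lee_sum => i _; rewrite EFinM fineK.
Qed.

Let finite_or_infinite_loss theta :
  (exists i, ell theta (z i) = +oo) \/
  exists r : 'I_N -> R, forall i, ell theta (z i) = (r i)%:E.
Proof.
have [|/forallNP lfin] := pselect (exists i, ell theta (z i) = +oo).
  by left.
right; exists (fun i => fine (ell theta (z i))) => i.
have := ell_gtNy i theta; have := lfin i.
by case: (ell theta (z i)).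
Qed.

(** Sum the Fenchel-Young inequalities at t_i = q_i / p_i with weights p_i. *)
Lemma weak_duality theta lambda mu : robust theta <= dual theta lambda mu.
Proof.
have [[i ly]|[r rE]] := finite_or_infinite_loss theta.
  by rewrite (dual_objective_infinite _ _ _ _ ly) leey.
apply: ge_ereal_sup => _ [q qS <-].
rewrite {1}/indicator; case: ifPn => [|_]; last by rewrite addeNy leNye.
rewrite inE sube0 => qB; have [qfin qeps] := ball_divergence_le _ qB.
rewrite /dual /dual_objective; case: ifPn => [lam0|_]; last exact: leey.
pose t i := (q 0 i / p 0 i)%R.
have t0 i : (0 <= t i)%R by apply: divr_ge0; [case: qS|exact: ltW].
have -> : \sum_i (q 0%R i)%:E * ell theta (z i) =
    (\sum_i q 0 i * r i)%:E.
  by rewrite -sumEFin; apply: eq_bigr => i _; rewrite rE EFinM.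
apply: (@le_trans _ _ ((lambda * eps + mu)%:E +
    (\sum_i p 0 i * (t i * (r i - mu) - lambda * fine (phi (t i))))%:E)).
  rewrite -EFinD lee_fin.
  rewrite [X in (_ <= _ + X)%R](eq_bigr (fun i => q 0 i * r i - mu * q 0 i -
      lambda * (p 0 i * fine (phi (t i)))))%R; last first.
    by move=> i _; rewrite /t; field; rewrite gt_eqF.
  rewrite !sumrB -!mulr_sumr (proj2 qS).
  by have := ler_wpM2l lam0 qeps; rewrite /t; lra.
rewrite leeD2l// -sumEFin; apply: lee_sum => i _.
rewrite EFinM lee_pmul2l ?lte_fin// EFinB EFinM EFinB -rE.
by apply: fenchel_young => //; exact: qfin.
Qed.

(** Both multipliers are found by looking at positive densities alone, on which
    phi is a real convex function; [conjugate_persp_sup] then turns the bound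
    on these densities into one on the dual objective. *)
Lemma strong_duality theta : exists lm, dual theta lm.1 lm.2 <= robust theta.
Proof.
have [[i ly]|[r rE]] := finite_or_infinite_loss theta.
  by exists (0, 0)%R; rewrite (robust_loss_infinite _ _ ly) leey.
have sumE q : \sum_i (q 0%R i)%:E * ell theta (z i) = (\sum_i q 0 i * r i)%:E.
  by rewrite -sumEFin; apply: eq_bigr => i _; rewrite rE EFinM.
case VE : (robust theta) => [V| |]; last 2 first.
- by exists (0, 0)%R; rewrite leey.
- by have := robust_loss_ge _ theta reference_in_ball; rewrite VE sumE.
have sum_p := proj2 p_simplex.
pose f t := fine (phi t).
have f1 : f 1%R = 0%R by rewrite /f phi1.
have primal t : (forall i, 0 < t i)%R -> (\sum_i p 0 i * t i = 1)%R ->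
    (\sum_i p 0 i * f (t i) <= eps)%R ->
    (\sum_i p 0 i * (t i * r i) <= V)%R.
  move=> t0 t1 tD.
  pose q : 'rV[R]_N := \row_i (p 0 i * t i)%R.
  have qS : prob_simplex q.
    split => [i|]; first by rewrite mxE mulr_ge0// ltW.
    by rewrite -t1; apply: eq_bigr => i _; rewrite mxE.
  have qB : ball q.
    split => //; rewrite divergence_simplex//.
    rewrite (eq_bigr (fun i => (p 0%R i * f (t i))%:E)).
      by rewrite sumEFin lee_fin.
    move=> i _; rewrite mxE [(p 0 i * t i)%R]mulrC mulfK ?gt_eqF//.
    by rewrite EFinM fineK// phi_fin.
  have := robust_loss_ge _ theta qB; rewrite VE sumE lee_fin.
  by congr (_ <= _)%R; apply: eq_bigr => i _; rewrite mxE mulrA.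
have [lambda lam0 lamP] :=
  divergence_lagrange _ _ _ p_gt0 sum_p f1 fine_convex _ _ eps_gt0 primal.
have [mu muP] := mass_lagrange _ _ _ p_gt0 sum_p fine_convex _ _ _ lam0 lamP.
exists (lambda, mu); rewrite /dual /dual_objective lam0/=.
have := sum_sup_le _ _ [set t | (0 < t)%R] _ _
  (fun i t => t * (r i - mu) - lambda * f t)%R _ _ ltr01 p_gt0 sum_p muP.
congr (_ + _ <= _); apply: eq_bigr => i _; congr (_ * _).
rewrite conjugate_persp_sup//; last exact: shift_gtNy.
congr (ereal_sup _); apply: eq_imagel => t _.
by rewrite rE EFinB EFinM EFinB.
Qed.

(** * Regularity of the dual objective *)

(** The product t (loss - mu) is expanded, so as to separate the loss, which is
    extended-real, from a real function of (lambda, mu). *)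
Let perspective_term i (x : 'rV[R]_n * (R^o * R^o)) (t : R) : \bar R :=
  t%:E * ell x.1 (z i) + (- (t * x.2.2 + x.2.1 * fine (phi t)))%:E.

Let perspective_term_gtNy i x t : (0 < t)%R -> -oo < perspective_term i x t.
Proof.
by move=> t0; apply: adde_gtNy; [exact: mule_gtNy|exact: ltNyr].
Qed.

Let perspective_sup i (x : 'rV[R]_n * (R^o * R^o)) : \bar R :=
  ereal_sup [set perspective_term i x t | t in [set t | (0 < t)%R]].

Let perspective_sup_gtNy i x : -oo < perspective_sup i x.
Proof.
apply: (lt_le_trans (perspective_term_gtNy i x _ ltr01)).
by apply: ereal_sup_ubound; exists 1%R => //=; exact: ltr01.
Qed.

(** The formula for lambda >= 0, extended to all lambda: it keeps its regularity
    on the whole space, and the constraint lambda >= 0 is imposed afterwards. *)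
Let objective_sup (x : 'rV[R]_n * (R^o * R^o)) : \bar R :=
  (x.2.1 * eps + x.2.2)%:E + \sum_i (p 0%R i)%:E * perspective_sup i x.

Let objective_dom : {pred 'rV[R]_n * (R^o * R^o)} :=
  [pred x | (0 <= (x.2.1 : R))%R].

Let dual_objectiveE :
  (fun x : 'rV[R]_n * (R^o * R^o) => dual x.1 x.2.1 x.2.2) =
  (fun x => if x \in objective_dom then objective_sup x else +oo).
Proof.
apply/funext => -[theta [lambda mu]]; rewrite /dual /dual_objective inE/=.
case: ifPn => // lam0; congr (_ + _); apply: eq_bigr => i _; congr (_ * _).
rewrite conjugate_persp_sup//; last exact: shift_gtNy.
congr (ereal_sup _); apply: eq_imagel => t /= t0.
rewrite /perspective_term/= muleDr//; last exact: fin_num_adde_defl.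
rewrite -addeA; congr (_ + _).
by rewrite -EFinM -EFinB mulrN opprD.
Qed.

Let term_sum_gtNy x : -oo < \sum_i (p 0%R i)%:E * perspective_sup i x.
Proof. by apply: sume_gtNy => i; exact: mule_gtNy. Qed.

Let objective_sup_gtNy x : -oo < objective_sup x.
Proof. by apply: adde_gtNy; [exact: ltNyr|exact: term_sum_gtNy]. Qed.

Let fst_continuous : continuous (fun x : 'rV[R]_n * (R^o * R^o) => x.1).
Proof. by move=> x; exact: cvg_fst. Qed.

Let lambda_continuous :
  continuous (fun x : 'rV[R]_n * (R^o * R^o) => x.2.1 : R).
Proof.
move=> x; apply: (@continuous_comp _ (R^o * R^o)%type R snd fst x).
  exact: cvg_snd.
exact: cvg_fst.
Qed.

Let mu_continuous :
  continuous (fun x : 'rV[R]_n * (R^o * R^o) => x.2.2 : R).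
Proof.
by move=> x; apply: (@continuous_comp _ (R^o * R^o)%type R snd snd x);
  exact: cvg_snd.
Qed.

Lemma dual_objective_lsc :
  (forall i, lower_semicontinuous (fun theta => ell theta (z i))) ->
  lower_semicontinuous
    (fun x : 'rV[R]_n * (R^o * R^o) => dual x.1 x.2.1 x.2.2).
Proof.
move=> ell_lsc; rewrite dual_objectiveE; apply: lower_semicontinuous_extend.
  exact: (closed_comp (fun x _ => lambda_continuous x) (closed_ge (y := 0%R))).
apply: lower_semicontinuousD => //.
- by move=> x; exact: ltNyr.
- apply: lower_semicontinuous_continuous => x.
  by apply: cvgD; [apply: cvgMl; exact: lambda_continuous|exact: mu_continuous].
apply: lower_semicontinuous_sum => [i x|i]; first exact: mule_gtNy.
apply: lower_semicontinuousZl => //.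
apply: lower_semicontinuous_sup => t /= t0.
apply: lower_semicontinuousD.
- by move=> x; exact: mule_gtNy.
- by move=> x; exact: ltNyr.
- apply: lower_semicontinuousZl => //.
  exact: (lower_semicontinuous_comp _ _ _ _ _ fst_continuous (ell_lsc i)).
- apply: lower_semicontinuous_continuous => x.
  apply: cvgN; apply: cvgD.
    by apply: cvgMr; exact: mu_continuous.
  by apply: cvgMl; exact: lambda_continuous.
Qed.

Lemma dual_objective_convex :
  (forall i, convex_efun (fun theta => ell theta (z i))) ->
  convex_efun (fun x : 'rV[R]_n * (R^o * R^o) => dual x.1 x.2.1 x.2.2).
Proof.
move=> ell_cvx; rewrite dual_objectiveE; apply: convex_efun_extend => //.
  move=> x y t /andP[t0 t1]; rewrite !inE/= => x0 y0.
  by rewrite addr_ge0// mulr_ge0 ?subr_ge0// ltW.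
apply: convex_efunD => //.
- by move=> x; exact: ltNyr.
- move=> x y t _; rewrite -!EFinM -EFinD lee_fin/=.
  by rewrite /GRing.scale/= le_eqVlt; apply/orP; left; apply/eqP; ring.
apply: convex_efun_sum => [i x|i]; first exact: mule_gtNy.
apply: convex_efunZl => //.
apply: convex_efun_sup => t /= t0.
apply: convex_efunD.
- by move=> x; exact: mule_gtNy.
- by move=> x; exact: ltNyr.
- apply: convex_efunZl => // x y a a01; exact: ell_cvx.
- move=> x y a _; rewrite -!EFinM -EFinD lee_fin/=.
  by rewrite /GRing.scale/= le_eqVlt; apply/orP; left; apply/eqP; ring.
Qed.

Lemma dual_objective_proper :
  \bigcap_(i in [set: 'I_N]) edom (fun theta => ell theta (z i)) !=set0 ->
  proper_efun (fun x : 'rV[R]_n * (R^o * R^o) => dual x.1 x.2.1 x.2.2).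
Proof.
case=> theta ltheta; split => [x|]; first exact: dual_objective_gtNy.
pose mu := (\sum_i `|fine (ell theta (z i))|)%R.
(* At lambda = 0 the dual objective is mu as soon as mu dominates all losses. *)
exists (theta, (0, mu))%R; rewrite /edom/= /dual /dual_objective lexx.
rewrite big1 ?adde0// => i _.
rewrite /conjugate_persp eqxx /indicator ifT ?mule0// inE/=.
rewrite -(fineK (ltheta i I)) -EFinB lee_fin subr_le0.
apply: (le_trans (ler_norm _)); rewrite /mu (bigD1 i)//= lerDl.
by apply: sumr_ge0 => j _; exact: normr_ge0.
Qed.

(** Since strong duality holds with some (lambda, mu), weak duality makes that
    pair a minimizer. *)
Lemma robust_loss_dual theta : exists2 lm,
  argmin (fun lm : R * R => dual theta lm.1 lm.2) lm &
  robust theta = dual theta lm.1 lm.2.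
Proof.
have [lm lmP] := strong_duality theta.
exists lm; first by move=> lm'; apply: (le_trans lmP); exact: weak_duality.
by apply/eqP; rewrite eq_le lmP weak_duality.
Qed.

End objectives.
End perspective.

Theorem proposition9 (R : realType) (N d n : nat)
  (hN : (1 <= N)%N) (hd : (1 <= d)%N) (hn : (1 <= n)%N)
  (p : 'rV[R]_N) (hp : prob_simplex p) (hp0 : forall i, (0 < p 0 i)%R)
  (z : 'I_N -> 'rV[R]_d)
  (ell : 'rV[R]_n -> 'rV[R]_d -> \bar R)
  (hell_ninfty : forall i theta, -oo < ell theta (z i))
  (hell_lsc : forall i, lower_semicontinuous (fun theta => ell theta (z i)))
  (hell_convex : forall i, convex_efun (fun theta => ell theta (z i)))
  (hell_dom :
    \bigcap_(i in [set: 'I_N]) edom (fun theta => ell theta (z i)) !=set0)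
  (phi : R -> \bar R)
  (hphi_ge0 : forall t, 0 <= phi t)
  (hphi_lsc : lower_semicontinuous phi)
  (hphi_convex : convex_efun (phi : R^o -> \bar R))
  (hphi_dom : edom phi = `]0%R, +oo[%classic \/ edom phi = `[0%R, +oo[%classic)
  (hphi1 : phi 1%R = 0)
  (eps : R) (heps : (0 < eps)%R) :
  let alpha := indicator (divergence_ball phi p eps) in
  let g := dual_objective ell z phi p eps in
  let g_uncurried :=
    fun x : 'rV[R]_n * (R^o * R^o) => g x.1 x.2.1 x.2.2 in
  [/\ proper_efun g_uncurried,
      lower_semicontinuous g_uncurried,
      convex_efun g_uncurried,
      (* the infimum over (lambda, mu) is a minimum *)
      forall theta, argmin (fun lm : R * R => g theta lm.1 lm.2) !=set0
    & argmin (robust_loss ell z alpha) =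
      argmin (fun theta : 'rV[R]_n =>
        ereal_inf (range (fun lm : R * R => g theta lm.1 lm.2)))].
Proof.
move=> alpha g g_uncurried.
have phi_fin t : (0 < t)%R -> phi t \is a fin_num.
  move=> t0; suff : edom phi t by [].
  by case: hphi_dom => ->; rewrite /= in_itv/= andbT// ltW.
have phi_neg t : (t < 0)%R -> phi t = +oo.
  move=> t0; have : ~ edom phi t.
    case: hphi_dom => ->; rewrite /= in_itv/= andbT.
      by rewrite lt_gtF.
    by rewrite leNgt t0.
  rewrite /edom/= fin_numE => /negP; rewrite negb_and !negbK => /orP[|] /eqP//.
  by have := hphi_ge0 t => + phiNy; rewrite phiNy.
have robustE theta := robust_loss_dual phi hphi_ge0 hphi_convex phi_fin phi_neg
  hphi1 N d n p eps hp hp0 heps ell z hell_ninfty theta.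
split.
- exact: dual_objective_proper.
- exact: dual_objective_lsc.
- exact: dual_objective_convex.
- by move=> theta; have [lm] := robustE theta; exists lm.
- congr argmin; apply/funext => theta; have [lm lmP ->] := robustE theta.
  apply/eqP; rewrite eq_le; apply/andP; split.
    by apply: le_ereal_inf_tmp => _ [lm' _ <-]; exact: lmP.
  by apply: ereal_inf_lbound; exists lm.
Qed.
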